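(* Let $p:X\to Y$ be a quasi-Galoisian branched covering possibly branched over $S\subset Y$. For all $b\in Y$, all $\hat b\in p^{-1}(b)$ and all bases $(U_i)_{i\in I}$ of connected open neighborhoods of $b$, there is a homeomorphism $$p^{-1}(b)\simeq\varprojlim_{i\in I}\Gamma(X/Y)/\Gamma_{\hat U_i},$$ where $\hat U_i$ is the connected component of $\hat b$ in $p^{-1}(U_i)$ for $i\in I$.
   Context: All topological spaces are Hausdorff, locally path connected and first countable (projective limits are taken in the category of Hausdorff topological spaces). A subset $D$ of a space $X$ is locally connected in $X$ if $U\cap D$ is connected for every open connected $U\subset X$. A subset is portly in $X$ if it is open, dense and locally connected in $X$. A spread $p:X\to Y$ is a continuous map such that the connected components of preimages $p^{-1}(U)$ of open subsets $U\subset Y$ generate the topology of $X$. It is complete if for every $y\in\overline{p(X)}$ and every inclusion-increasing assignment $\chi$ associating to each open connected neighborhood $U$ of $y$ a connected component $\chi(U)$ of $p^{-1}(U)$, one has $\bigcap_U\chi(U)\neq\emptyset$. A completion of a spread $X\to Y$ is a complete spread $X'\to Y$ with an embedding $X\to X'$ over $Y$ whose image is open, dense and locally connected in $X'$; every spread has a completion, unique up to isomorphism. The ordinary locus $\mathrm{Ord}(Y)$ is the set of $y\in Y$ having an open neighborhood $U$ such that each connected component of $p^{-1}(U)$ is mapped homeomorphically onto $U$ by $p$, and $\mathrm{Ord}(X)=p^{-1}(\mathrm{Ord}(Y))$. A branched covering is a complete surjective spread $X\to Y$ with $X,Y$ connected and $\mathrm{Ord}(X)$, $\mathrm{Ord}(Y)$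 portly in $X$, $Y$; it is possibly branched over $S$ if $Y\setminus\mathrm{Ord}(Y)\subset S$. $\Gamma(X/Y)$ denotes the group of homeomorphisms $\varphi$ of $X$ with $p\circ\varphi=p$; for $V\subset X$, $\Gamma_V$ is the set-wise stabilizer of $V$ in $\Gamma(X/Y)$. A covering or branched covering is Galoisian if its automorphism group acts transitively on its fibers; a branched covering $X\to Y$ is quasi-Galoisian if it is the completion of a Galoisian covering (i.e. of the spread $X_1\to Y$ given by a Galoisian covering $X_1\to Y_1$ of a portly subset $Y_1\subset Y$). The index set $I$ is directed by reverse inclusion of the $U_i$, the coset spaces $\Gamma(X/Y)/\Gamma_{\hat U_i}$ are discrete, and the bonding maps are the natural maps $\Gamma(X/Y)/\Gamma_{\hat U_i}\to\Gamma(X/Y)/\Gamma_{\hat U_j}$ for $U_i\subset U_j$. *)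

(* Defs.v *)
From HB Require Import structures.
From mathcomp Require Import all_boot all_order all_algebra.
From mathcomp Require Import all_classical all_reals topology normedtype.

Set Implicit Arguments.
Unset Strict Implicit.
Unset Printing Implicit Defensive.

Import Order.TTheory GRing.Theory Num.Theory.
Import numFieldNormedType.Exports.
Local Open Scope classical_set_scope.
Local Open Scope ring_scope.

Definition homeomorphism (T U : topologicalType) (f : T -> U) :=
  continuous f /\ exists g : U -> T, [/\ continuous g, cancel f g & cancel g f].

Definition homeomorphic (T U : topologicalType) :=
  exists f : T -> U, homeomorphism f.

(** The subsets [A] and [B] are the spaces [set_type A] and [set_type B] with the
    induced topology, not the library's [subspace A], which keeps the points
    outside [A] as isolated points. *)
Definition homeo_onto (T U : topologicalType) (f : T -> U)
    (A : set T) (B : set U) :=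
  exists h : set_type A -> set_type B,
    homeomorphism h /\ forall x, set_val (h x) = f (set_val x).

Definition embedding (T U : topologicalType) (f : T -> U) :=
  exists h : T -> set_type (range f),
    homeomorphism h /\ forall x, set_val (h x) = f x.

Definition path_connected (R : realType) (T : topologicalType) (A : set T) :=
  forall x y, A x -> A y -> exists f : R -> T,
    [/\ {within `[0, 1], continuous f}, f 0 = x, f 1 = y &
        f @` `[0, 1] `<=` A].

Definition locally_path_connected (R : realType) (T : topologicalType) :=
  forall (x : T) (U : set T), nbhs x U ->
    exists V : set T, [/\ nbhs x V, V `<=` U & path_connected R V].

Definition first_countable (T : topologicalType) :=
  forall x : T, exists B : set (set T),
    [/\ countable B, B `<=` nbhs x &
        forall U, nbhs x U -> exists2 V, B V & V `<=` U].

(** [R] only provides the unit interval on which paths are parametrized. *)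
Definition nice_space (R : realType) (T : topologicalType) :=
  [/\ hausdorff_space T, locally_path_connected R T & first_countable T].

Definition connected_open_nbhs (T : topologicalType) (x : T) : set (set T) :=
  [set U | open_nbhs x U /\ connected U].

Definition components (T : topologicalType) (A : set T) : set (set T) :=
  connected_component A @` A.

Definition locally_connected_in (T : topologicalType) (D : set T) :=
  forall U : set T, open U -> connected U -> connected (U `&` D).

Definition portly (T : topologicalType) (D : set T) :=
  [/\ open D, dense D & locally_connected_in D].

Definition is_topology (T : Type) (O : set (set T)) :=
  [/\ O setT, setI_closed O &
      forall F : set (set T), F `<=` O -> O (\bigcup_(A in F) A)].

Section Spreads.
Variables X Y : topologicalType.
Implicit Types (p : X -> Y) (S : set Y).

Definition spread p :=
  continuous p /\
  @open X = smallest (@is_topology X)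
    [set C | exists2 U : set Y, open U & components (p @^-1` U) C].

Definition complete p :=
  forall y : Y, closure (range p) y ->
  forall chi : set Y -> set X,
    (forall U, connected_open_nbhs y U -> components (p @^-1` U) (chi U)) ->
    (forall U V, connected_open_nbhs y U -> connected_open_nbhs y V ->
      U `<=` V -> chi U `<=` chi V) ->
    \bigcap_(U in connected_open_nbhs y) chi U !=set0.

Definition Ord_base p : set Y :=
  [set y | exists2 U : set Y, open_nbhs y U &
    forall C, components (p @^-1` U) C -> homeo_onto p C U].

Definition Ord_total p : set X := p @^-1` Ord_base p.

Definition branched_covering p :=
  [/\ spread p, complete p & range p = setT] /\
  [/\ connected [set: X], connected [set: Y],
      portly (Ord_total p) & portly (Ord_base p)].

Definition possibly_branched_over p S := ~` Ord_base p `<=` S.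

Definition covering p :=
  [/\ continuous p, range p = setT & forall y : Y, exists2 V, open_nbhs y V &
    exists F : set (set X),
      [/\ F `<=` open, trivIset F id, \bigcup_(A in F) A = p @^-1` V &
          forall A, F A -> homeo_onto p A V]].

Definition deck p :=
  set_type [set phi : X -> X | homeomorphism phi /\ p \o phi = p].
HB.instance Definition _ p := Choice.on (deck p).

Section DeckGroup.
Variable p : X -> Y.
Implicit Types phi psi : deck p.

Lemma deckP phi : homeomorphism (val phi) /\ p \o val phi = p.
Proof. by case: phi => f /= /set_mem. Qed.

Lemma deck_eq phi psi : val phi =1 val psi -> phi = psi.
Proof. by move=> e; apply: val_inj; apply/funext. Qed.

Definition mk_deck (f : X -> X) (fh : homeomorphism f) (pf : p \o f = p) :
  deck p := exist _ f (mem_set (conj fh pf)).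

Lemma homeomorphism_id : homeomorphism (@id X).
Proof. by split=> [x //|]; exists id; split=> // x; exact. Qed.

Definition deck_one : deck p := mk_deck homeomorphism_id erefl.

Lemma homeomorphism_comp (f g : X -> X) :
  homeomorphism f -> homeomorphism g -> homeomorphism (f \o g).
Proof.
move=> [cf [f' [cf' fK f'K]]] [cg [g' [cg' gK g'K]]]; split.
  by move=> x; apply: continuous_comp; [exact: cg|exact: cf].
exists (g' \o f'); split; last 2 first.
- exact: can_comp.
- exact: can_comp.
- by move=> x; apply: continuous_comp; [exact: cf'|exact: cg'].
Qed.

Lemma deck_mul_subproof phi psi : p \o (val phi \o val psi) = p.
Proof. by rewrite compA (deckP phi).2 (deckP psi).2. Qed.

Definition deck_mul phi psi : deck p :=
  mk_deck (homeomorphism_comp (deckP phi).1 (deckP psi).1)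
          (deck_mul_subproof phi psi).

Lemma deck_inv_subproof phi : exists psi : deck p,
  cancel (val phi) (val psi) /\ cancel (val psi) (val phi).
Proof.
have [[cf [f' [cf' fK f'K]]] pf] := deckP phi.
have hf' : homeomorphism f' by split=> //; exists (val phi).
have pf' : p \o f' = p.
  by rewrite -[in LHS]pf; apply/funext => x /=; rewrite f'K.
by exists (mk_deck hf' pf').
Qed.

Definition deck_inv phi : deck p := sval (cid (deck_inv_subproof phi)).

Lemma deck_mulA : associative deck_mul.
Proof. by move=> ? ? ?; exact: deck_eq. Qed.

Lemma deck_mul1 : left_id deck_one deck_mul.
Proof. by move=> ?; exact: deck_eq. Qed.

Lemma deck_mulr1 : right_id deck_one deck_mul.
Proof. by move=> ?; exact: deck_eq. Qed.

Lemma deck_mulV : left_inverse deck_one deck_inv deck_mul.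
Proof.
by move=> phi; apply: deck_eq => x /=; rewrite /deck_inv; case: cid => ? /= [].
Qed.

Lemma deck_mulrV : right_inverse deck_one deck_inv deck_mul.
Proof.
by move=> phi; apply: deck_eq => x /=; rewrite /deck_inv; case: cid => ? /= [].
Qed.

HB.instance Definition _ := isGroup.Build (deck p)
  deck_mulA deck_mul1 deck_mulr1 deck_mulV deck_mulrV.

Definition stabilizer (V : set X) : set (deck p) :=
  [set phi | val phi @` V = V].

End DeckGroup.

Definition transitive_on_fibers p :=
  forall x x' : X, p x = p x' -> exists phi : deck p, val phi x = x'.

Definition galoisian_covering p := covering p /\ transitive_on_fibers p.

End Spreads.

(** [p : X -> Y] is, via [j], a completion of the spread [q : X1 -> Y]. *)
Definition is_completion (X1 X Y : topologicalType)
    (q : X1 -> Y) (p : X -> Y) (j : X1 -> X) :=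
  [/\ spread q, spread p, complete p, embedding j & p \o j = q] /\
  portly (range j).

Definition quasi_galoisian (R : realType) (X Y : topologicalType) (p : X -> Y) :=
  exists (Y1 : set Y) (X1 : topologicalType) (p1 : X1 -> set_type Y1)
         (j : X1 -> X),
    [/\ portly Y1, nice_space R X1, galoisian_covering p1 &
        is_completion (set_val \o p1) p j].

Section Cosets.
Variable G : groupType.
Implicit Types (H K : set G) (g : G).

Definition lcoset H g : set G := [set (g * h)%g | h in H].

Definition cosets H := discrete_topology (set_type (range (lcoset H))).

Lemma lcoset_range H g : lcoset H g \in range (lcoset H).
Proof. by apply/mem_set; exists g. Qed.

Definition to_coset H g : cosets H := SigSub (lcoset_range H g).

Lemma coset_repr_subproof H (c : cosets H) : exists g, to_coset H g = c.
Proof.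
case: c => A AP; have [g _ gA] := set_mem AP.
by exists g; apply: val_inj.
Qed.

Definition coset_repr H (c : cosets H) : G := sval (cid (coset_repr_subproof c)).

(** The natural map [gH |-> gK]; it is independent of the chosen representative
    when [H] and [K] are subgroups with [H `<=` K], see [coset_mapE]. *)
Definition coset_map H K (c : cosets H) : cosets K := to_coset K (coset_repr c).

Definition is_subgroup H :=
  [/\ H 1%g, forall x y, H x -> H y -> H (x * y)%g & forall x, H x -> H (x^-1)%g].

Lemma coset_mapE H K : is_subgroup H -> is_subgroup K -> H `<=` K ->
  forall g, coset_map K (to_coset H g) = to_coset K g.
Proof.
move=> [H1 _ _] [K1 KM KV] HK g; rewrite /coset_map /coset_repr.
case: cid => g' /= e; apply: val_inj => /=.
have [h /HK Kh gh] : lcoset H g g'.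
  by move/(congr1 val): e => /= <-; exists 1%g => //; exact: mulg1.
apply/seteqP; split => _ [k Kk <-]; rewrite -gh.
- by exists (h * k)%g; [exact: KM|rewrite mulgA].
- by exists (h^-1 * k)%g; [apply: KM => //; exact: KV|rewrite mulgA mulgK].
Qed.

End Cosets.

Lemma stabilizer_subgroup (X Y : topologicalType) (p : X -> Y) (V : set X) :
  is_subgroup (@stabilizer X Y p V).
Proof.
split.
- by rewrite /stabilizer /=; exact: image_id.
- move=> phi psi phiV psiV; change ((val phi \o val psi) @` V = V).
  by rewrite -image_comp psiV phiV.
- move=> phi phiV; apply/seteqP; split=> [_ [x + <-]|x Vx].
  + rewrite -{1}phiV => -[y Vy <-].
    suff -> : val (phi^-1)%g (val phi y) = y by [].
    exact: (congr1 (fun f : deck p => val f y) (mulVg phi)).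
  + exists (val phi x); first by rewrite -phiV; exists x.
    exact: (congr1 (fun f : deck p => val f x) (mulVg phi)).
Qed.

(** The limit, in the product space, of a system of spaces indexed by [I]
    preordered by [le], with maps [T i -> T j] for [le i j]. *)
Definition projlim (I : Type) (le : I -> I -> Prop) (T : I -> topologicalType)
    (f : forall i j, T i -> T j) : set (prod_topology T) :=
  [set x | forall i j, le i j -> f i j (x i) = x j].

Definition connected_nbhs_basis (T : topologicalType) (x : T)
    (I : Type) (U : I -> set T) :=
  (forall i, connected_open_nbhs x (U i)) /\
  (forall V, nbhs x V -> exists i, U i `<=` V).

(* Main.v *)
Require Import Defs.
From mathcomp Require Import all_boot all_order all_algebra.
From mathcomp Require Import all_classical all_reals topology normedtype.

Set Implicit Arguments.
Unset Strict Implicit.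
Unset Printing Implicit Defensive.

Import Order.TTheory GRing.Theory Num.Theory.
Import numFieldNormedType.Exports.
Local Open Scope classical_set_scope.

(** Points of the fibre over [b] are described by the components of the
    preimages of small connected neighbourhoods of [b], and the automorphism
    group permutes these components transitively. So a component of
    [p @^-1` U i] is the same thing as a coset of the stabilizer of one of them,
    and a point of the fibre becomes a compatible family of cosets.

    Two properties of [p] make this correspondence a homeomorphism. Since [p] is
    a spread, the components containing [x] form a neighbourhood basis of [x]
    ([spread_basis]); this gives injectivity and, the coset spaces being
    discrete, the continuity of the inverse. Since [p] is complete, a compatible
    family of components has a common point ([thread_point]); this gives
    surjectivity. The forward map is continuous because components of open sets
    are open in a locally connected space. This part of the argument is
    [fiber_homeomorphic_projlim], which takes transitivity on components as a
    hypothesis.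

    Transitivity is where the Galois hypothesis enters. The automorphisms of the
    Galois covering [p1 : X1 -> Y1] of which [p] is the completion extend to [X],
    because a completion is universal: a morphism of spreads from [X1] to a
    complete spread extends to the completion of [X1]
    ([completion_universal], [deck_extension]). As [p1] is open, the part of
    a component of [p @^-1` U] that lies in [X1] has an open image in
    [U `&` Y1], and two such images are equal or disjoint, since an automorphism
    matching two points of the same fibre carries one component to the other.
    Now [U `&` Y1] is connected, so all these images are equal, hence any
    component is carried to any other ([transitive_on_components]). *)

Local Notation sheet p U x := (connected_component (p @^-1` U) x).

(** * Local connectedness *)

Definition locally_connected (T : topologicalType) :=
  forall (x : T) (N : set T), nbhs x N ->
    exists2 U, connected_open_nbhs x U & U `<=` N.

Lemma path_connected_connected (R : realType) (T : topologicalType)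
    (A : set T) :
  path_connected R A -> connected A.
Proof.
move=> pA; have [->|/set0P[x Ax]] := eqVneq A set0; first exact: connected0.
suff -> : A = connected_component A x by exact: component_connected.
apply/seteqP; split; last exact: connected_component_sub.
move=> y Ay; have [f [cf f0 f1 fA]] := pA x y Ax Ay.
exists (f @` `[0%R, 1%R]).
  split=> //; first by exists 0%R => //=; rewrite in_itv /= lexx ler01.
  apply: connected_continuous_connected => //.
  exact: segment_connected.
by exists 1%R => //=; rewrite in_itv /= lexx ler01.
Qed.

Lemma locally_connected_of_paths (R : realType) (T : topologicalType) :
  locally_path_connected R T -> locally_connected T.
Proof.
move=> lpT.
have op (A : set T) x : open A -> open (connected_component A x).
  move=> oA; rewrite openE => y xy; rewrite /interior.
  have Ay : A y by exact: connected_component_sub xy.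
  have [V [yV VA /path_connected_connected Vc]] :=
    lpT y A (open_nbhs_nbhs (conj oA Ay)).
  apply: (filterS _ yV); rewrite (same_connected_component xy).
  by apply: connected_component_max => //; exact: nbhs_singleton yV.
move=> x N; rewrite nbhsE => -[O [oO Ox] ON].
exists (connected_component O x); last first.
  exact: subset_trans (@connected_component_sub _ _ _) ON.
split; last exact: component_connected.
by split; [exact: op|exact: connected_component_refl].
Qed.

Lemma open_component (T : topologicalType) (A : set T) (x : T) :
  locally_connected T -> open A -> open (connected_component A x).
Proof.
move=> lcT oA; rewrite openE => y xy; rewrite /interior.
have Ay : A y by exact: connected_component_sub xy.
have [V [[oV Vy] Vc] VA] := lcT y A (open_nbhs_nbhs (conj oA Ay)).
apply: filterS (open_nbhs_nbhs (conj oV Vy)).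
by rewrite (same_connected_component xy); exact: connected_component_max.
Qed.

(** * Spreads and completeness *)

Lemma sheet_mono (X Y : topologicalType) (p : X -> Y) (U V : set Y) (x : X) :
  U `<=` V -> U (p x) -> sheet p U x `<=` sheet p V x.
Proof.
move=> UV Ux; apply: connected_component_max.
- exact: connected_component_refl.
- by move=> z /connected_component_sub /UV.
- exact: component_connected.
Qed.

(** The topology of a spread is only assumed to be generated by the components.
    They form a basis because two components over [U] and [V] that meet at a
    point both contain the component of that point over [U `&` V]; shrinking the
    open set by local connectedness makes it connected. *)
Lemma spread_basis (X Y : topologicalType) (p : X -> Y) :
  locally_connected Y -> spread p ->
  forall x N, nbhs x N ->
    exists2 U, connected_open_nbhs (p x) U & sheet p U x `<=` N.
Proof.
move=> lcY [cp opE] x N; rewrite nbhsE => -[O [oO Ox] ON].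
(* The sets that are open for the would-be basis: a topology containing all the
   generators, hence all the open sets. *)
pose O' := [set A : set X | forall x, A x ->
  exists2 U, open_nbhs (p x) U & sheet p U x `<=` A].
have O'top : is_topology O'.
  split.
  - by move=> z _; exists setT => //; split => //; exact: openT.
  - move=> A B OA OB z [/OA[U [oU Uz] UA] /OB[V [oV Vz] VB]].
    exists (U `&` V); first by split => //; exact: openI.
    move=> w zw; split; [apply: UA|apply: VB]; move: w zw; apply: sheet_mono.
    + exact: subIsetl.
    + by split.
    + exact: subIsetr.
    + by split.
  - move=> F FO z [A FA Az]; have [U Uz UA] := FO A FA z Az.
    by exists U => //; apply: subset_trans UA _ => w Aw; exists A.
have openO' : @open X `<=` O'.
  rewrite opE; apply: smallest_sub => // _ [U oU [y Uy <-]] z yz; exists U.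
  - by split => //; exact: connected_component_sub yz.
  - by rewrite (same_connected_component yz).
have [U Ux UO] := openO' _ oO x Ox.
have [V [[oV Vx] Vc] VU] := lcY _ _ (open_nbhs_nbhs Ux).
exists V; first by split.
by apply: subset_trans ON; apply: subset_trans UO; exact: sheet_mono.
Qed.

Lemma hausdorff_eq (T : topologicalType) (x y : T) : hausdorff_space T ->
  (forall N, nbhs x N -> N y) -> x = y.
Proof.
move=> hT xy; apply: hT => A B xA yB; exists y; split; first exact: xy.
exact: nbhs_singleton.
Qed.

Lemma spread_separated (X Y : topologicalType) (p : X -> Y) (x x' : X) :
  hausdorff_space X -> locally_connected Y -> spread p ->
  (forall U, connected_open_nbhs (p x) U -> sheet p U x x') -> x = x'.
Proof.
move=> hX lcY sp xx'; apply: hausdorff_eq => // N.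
by move=> /(spread_basis lcY sp)[U Ux]; apply; exact: xx'.
Qed.

(** The form in which completeness is used: the common point of the thread
    [chi] lies over [y], because [y] is the only point common to all its
    neighbourhoods, and [chi] is the thread of components of that point. *)
Lemma thread_point (X Y : topologicalType) (p : X -> Y) (y : Y)
    (chi : set Y -> set X) :
  hausdorff_space Y -> locally_connected Y -> complete p ->
  closure (range p) y ->
  (forall U, connected_open_nbhs y U -> components (p @^-1` U) (chi U)) ->
  (forall U V, connected_open_nbhs y U -> connected_open_nbhs y V ->
    U `<=` V -> chi U `<=` chi V) ->
  exists x, p x = y /\
    forall U, connected_open_nbhs y U -> chi U = sheet p U x.
Proof.
move=> hY lcY cp yp chiC chiS.
have [x xchi] := cp y yp chi chiC chiS; exists x.
have chiE U : connected_open_nbhs y U -> chi U = sheet p U x /\ U (p x).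
  move=> Uy; have := xchi U Uy; have [z _ <-] := chiC U Uy => zx.
  by split; [exact: same_connected_component|exact: connected_component_sub zx].
split; last by move=> U /chiE[].
apply/esym/hausdorff_eq => // N /lcY[U Uy]; apply.
by have [] := chiE U Uy.
Qed.

(** * Extension of morphisms to a completion *)

Lemma embedding_open (T U : topologicalType) (f : T -> U) (A : set T) :
  embedding f -> open A -> exists2 B, open B & A = f @^-1` B.
Proof.
move=> [h [[ch [g [cg hK gK]]] hE]] oA.
have : open (g @^-1` A) by move/continuousP: cg; apply.
case=> B oB BE; exists B => //; apply/seteqP; split=> x.
- move=> Ax; rewrite /preimage /= -hE.
  have : (g @^-1` A) (h x) by rewrite /preimage /= hK.
  by rewrite -BE.
- rewrite /preimage /= -hE => Bx.
  have : (set_val @^-1` B) (h x) by [].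
  by rewrite BE /preimage /= hK.
Qed.

Lemma embedding_continuous (T U : topologicalType) (f : T -> U) :
  embedding f -> continuous f.
Proof.
move=> [h [[ch _] hE]].
have -> : f = set_val \o h by apply/funext => x /=; rewrite hE.
by move=> x; apply: continuous_comp; [exact: ch|exact: initial_continuous].
Qed.

Lemma connected_preimage_embedding (T U : topologicalType) (f : T -> U)
    (C : set U) :
  embedding f -> connected (C `&` range f) -> connected (f @^-1` C).
Proof.
move=> ef cC B B0 [O oO BO] [F cF BF].
have [O' oO' OE] := embedding_open ef oO.
have oFc : open (~` F) by exact: closed_openC.
have [F' oF' FE] := embedding_open ef oFc.
have FE' x : F x <-> ~ F' (f x).
  have -> : F' (f x) = (~` F) x by rewrite FE.
  by split=> [? //|/contrapT].
have H : C `&` range f `&` O' = C `&` range f.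
  apply: cC.
  - case: B0 => x; rewrite BO => -[Cx Ox]; exists (f x); split.
    + by split=> //; exists x.
    + by move: Ox; rewrite OE.
  - by exists O'.
  - exists (~` F'); first exact: open_closedC.
    apply/seteqP; split=> z [[Cx [x _ xz]]] Ox; subst z;
      (split; first by split=> //; exists x).
    + have : B x by rewrite BO OE; split.
      by rewrite BF => -[_ /FE'].
    + have : B x by rewrite BF; split=> //; exact/FE'.
      by rewrite BO OE => -[].
rewrite BO OE; apply/seteqP; split=> [x []//|x Cx]; split=> //.
have : (C `&` range f) (f x) by split=> //; exists x.
by rewrite -H => -[].
Qed.

Lemma eq_on_dense (T U : topologicalType) (D : set T) (f g : T -> U) :
  hausdorff_space U -> continuous f -> continuous g -> dense D ->
  {in D, f =1 g} -> f =1 g.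
Proof.
move=> hU cf cg dD fg x; apply: hU => A B fA gB.
have : nbhs x (f @^-1` A `&` g @^-1` B) by apply: filterI; [exact: cf|exact: cg].
rewrite nbhsE => -[O [oO Ox] OAB].
have [z [/OAB[Az Bz] Dz]] := dD O (ex_intro _ x Ox) oO.
by exists (f z); split=> //; rewrite fg//; exact: mem_set.
Qed.

(** A point [x] of [X] is approached by the sets [sheet p U x], whose traces on
    [X1] are connected; so [k] maps each trace into one component of
    [p' @^-1` U]. As [U] shrinks to [p x] these components form a thread, whose
    point is the value of the extension at [x]. *)
Lemma completion_universal (X1 X X' Y : topologicalType)
    (p : X -> Y) (p' : X' -> Y) (j : X1 -> X) (k : X1 -> X') :
  locally_connected X -> locally_connected Y ->
  hausdorff_space X' -> hausdorff_space Y ->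
  continuous p -> spread p' -> complete p' ->
  embedding j -> dense (range j) -> locally_connected_in (range j) ->
  continuous k -> p' \o k = p \o j ->
  exists f : X -> X', [/\ continuous f, p' \o f = p & f \o j = k].
Proof.
move=> lcX lcY hX' hY cp sp' cp' ej dj lj ck pk.
have pkE z : p' (k z) = p (j z) by exact: (congr1 (fun f => f z) pk).
have sheet_open U x : open U -> open (sheet p U x).
  by move=> oU; apply: open_component => //; move/continuousP: cp; exact.
have sheet_dense U x : connected_open_nbhs (p x) U ->
    exists z, sheet p U x (j z).
  move=> [[oU Ux] _]; have [|w [xw [z _ zw]]] := dj (sheet p U x) _ (sheet_open U x oU).
    by exists x; exact: connected_component_refl.
  by exists z; rewrite zw.
have sheet_lift U x z z' : connected_open_nbhs (p x) U ->
    sheet p U x (j z) -> sheet p U x (j z') -> sheet p' U (k z) = sheet p' U (k z').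
  move=> [[oU Ux] Uc] xz xz'; apply: same_connected_component.
  have := @connected_component_max _ (p' @^-1` U) (k @` (j @^-1` sheet p U x)) (k z).
  apply; last by exists z'.
  - by exists z.
  - move=> _ [w xw <-]; rewrite /preimage /= pkE.
    exact: connected_component_sub xw.
  - apply: connected_continuous_connected.
      apply: connected_preimage_embedding => //.
      apply: lj; [exact: sheet_open|exact: component_connected].
    exact: continuous_subspaceT.
(* The union is that of a family of equal sets; it spares choosing a point of
   the trace. *)
pose chi x U := \bigcup_(z in j @^-1` sheet p U x) sheet p' U (k z).
have chiE U x z : connected_open_nbhs (p x) U -> sheet p U x (j z) ->
    chi x U = sheet p' U (k z).
  move=> Ux xz; apply/seteqP; split; last by move=> w zw; exists z.
  by move=> w [z' xz']; rewrite (sheet_lift U x z' z).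
have fP x : exists x', p' x' = p x /\
    forall U, connected_open_nbhs (p x) U -> chi x U = sheet p' U x'.
  apply: thread_point => //.
  - move=> N Nx; have : nbhs x (p @^-1` N) by exact: cp.
    rewrite nbhsE => -[O [oO Ox] ON].
    have [w [Oz [z _ zw]]] := dj O (ex_intro _ x Ox) oO; subst w.
    by exists (p (j z)); split; [exists (k z)|exact: ON].
  - move=> U Ux; have [z xz] := sheet_dense U x Ux.
    exists (k z); last by rewrite (chiE _ _ z).
    by rewrite /preimage /= pkE; exact: connected_component_sub xz.
  - move=> U V Ux Vx UV; have [z xz] := sheet_dense U x Ux.
    have Uz := connected_component_sub xz.
    rewrite (chiE _ _ z)// (chiE _ _ z)//; last by apply: sheet_mono xz => //; case: Ux => -[].
    by apply: sheet_mono => //; rewrite pkE.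
have [f fE] := choice fP; exists f; split.
- move=> x N /(spread_basis lcY sp')[U]; rewrite (fE x).1 => Ux UN.
  have [[oU Upx] Uc] := Ux.
  have nx : nbhs x (sheet p U x).
    by apply: open_nbhs_nbhs; split; [exact: sheet_open|exact: connected_component_refl].
  apply: filterS nx => x' xx'; apply: UN.
  have Ux' : connected_open_nbhs (p x') U.
    by split=> //; split=> //; exact: connected_component_sub xx'.
  rewrite -(fE x).2 // /chi (same_connected_component xx') -/(chi x' U) (fE x').2 //.
  by apply: connected_component_refl; rewrite /preimage /= (fE x').1; case: Ux' => -[].
- by apply/funext => x; exact: (fE x).1.
- apply/funext => z /=; apply/esym; apply: (@spread_separated _ _ p') => // U.
  rewrite pkE => Uz; rewrite -(chiE U (j z)) //; last first.
    by apply: connected_component_refl; case: Uz => -[].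
  rewrite (fE (j z)).2 //; apply: connected_component_refl.
  by rewrite /preimage /= (fE _).1; case: Uz => -[].
Qed.

(** The extensions of [phi1] and of its inverse are mutually inverse, since they
    are so on a dense subset of a Hausdorff space. *)
Lemma deck_extension (X1 X Y : topologicalType) (p : X -> Y) (j : X1 -> X)
    (phi1 : X1 -> X1) :
  locally_connected X -> locally_connected Y ->
  hausdorff_space X -> hausdorff_space Y ->
  spread p -> complete p ->
  embedding j -> dense (range j) -> locally_connected_in (range j) ->
  homeomorphism phi1 -> p \o j \o phi1 = p \o j ->
  exists phi : deck p, val phi \o j = j \o phi1.
Proof.
move=> lcX lcY hX hY sp cp ej dj lj [c1 [psi1 [d1 phi1K psi1K]]] pphi1.
have cj := embedding_continuous ej.
have cont (f : X1 -> X1) : continuous f -> continuous (j \o f).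
  by move=> cf x; apply: continuous_comp; [exact: cf|exact: cj].
have ext := completion_universal lcX lcY hX hY sp.1 sp cp ej dj lj.
have [f [cf pf fj]] := ext _ (cont _ c1) pphi1.
have ppsi1 : p \o (j \o psi1) = p \o j.
  apply/funext => z /=; rewrite -[z in RHS]psi1K.
  by apply/esym; exact: (congr1 (fun g => g (psi1 z)) pphi1).
have [g [cg pg gj]] := ext _ (cont _ d1) ppsi1.
have fjE z : f (j z) = j (phi1 z) by exact: (congr1 (fun g => g z) fj).
have gjE z : g (j z) = j (psi1 z) by exact: (congr1 (fun g => g z) gj).
have cancels (u v : X -> X) : continuous u -> continuous v ->
    (forall z, v (u (j z)) = j z) -> cancel u v.
  move=> cu cv vu; apply: (@eq_on_dense _ _ (range j) (v \o u) id) => //.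
  - by move=> x; apply: continuous_comp; [exact: cu|exact: cv].
  - by move=> x.
  - by move=> _ /set_mem[z _ <-]; exact: vu.
have hf : homeomorphism f.
  split=> //; exists g; split=> //; apply: cancels => // z.
  - by rewrite fjE gjE phi1K.
  - by rewrite gjE fjE psi1K.
by exists (mk_deck hf pf).
Qed.

(** * Transitivity on the components of a preimage *)

Lemma homeo_onto_open (T U : topologicalType) (f : T -> U)
    (A O : set T) (V : set U) :
  homeo_onto f A V -> open V -> open O -> open (f @` (O `&` A)).
Proof.
move=> [h [[_ [g [cg hK gK]]] hE]] oV oO.
have : open (g @^-1` (set_val @^-1` O)).
  by move/continuousP: cg; apply; exists O.
move=> [W oW WE].
suff -> : f @` (O `&` A) = W `&` V by exact: openI.
apply/seteqP; split.
- move=> _ [x [Ox Ax] <-]; pose a : set_type A := SigSub (mem_set Ax).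
  have -> : f x = set_val (h a) by rewrite hE.
  split; last by apply: set_mem; exact: valP.
  have : (g @^-1` (set_val @^-1` O)) (h a) by rewrite /preimage /= hK.
  by rewrite -WE.
- move=> y [Wy Vy]; pose v : set_type V := SigSub (mem_set Vy).
  exists (set_val (g v)); last by rewrite -hE gK.
  split; last by apply: set_mem; exact: valP.
  have : (set_val @^-1` W) v by [].
  by rewrite WE.
Qed.

Lemma covering_open (X Y : topologicalType) (p : X -> Y) (O : set X) :
  covering p -> open O -> open (p @` O).
Proof.
move=> [_ _ cov] oO; rewrite openE => _ [x Ox <-]; rewrite /interior.
have [V [oV Vx] [F [Fo _ FV Fh]]] := cov (p x).
have [A FA Ax] : (\bigcup_(A in F) A) x by rewrite FV.
have oA := homeo_onto_open (Fh A FA) oV oO.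
have : nbhs (p x) (p @` (O `&` A)) by apply: open_nbhs_nbhs; split=> //; exists x.
by apply: filterS => _ [z [Oz _] <-]; exists z.
Qed.

Lemma open_set_val (T : topologicalType) (A : set T) (W : set (set_type A)) :
  open A -> open W -> open (set_val @` W).
Proof.
move=> oA [V oV <-].
suff -> : set_val @` (set_val @^-1` V : set A) = V `&` A by exact: openI.
apply/seteqP; split.
- by move=> _ [a Va <-]; split=> //; apply: set_mem; exact: valP.
- by move=> x [Vx Ax]; exists (SigSub (mem_set Ax)).
Qed.

Lemma deck_image_sheet (X Y : topologicalType) (p : X -> Y) (phi : deck p)
    (U : set Y) (x : X) :
  U (p x) -> val phi @` sheet p U x = sheet p U (val phi x).
Proof.
have sub (psi : deck p) z : U (p z) ->
    val psi @` sheet p U z `<=` sheet p U (val psi z).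
  move=> Uz; have [[cpsi _] ppsi] := deckP psi.
  apply: connected_component_max.
  - by exists z => //; exact: connected_component_refl.
  - move=> _ [w /connected_component_sub zw <-]; rewrite /preimage /=.
    by rewrite -[p (_ _)]/((p \o val psi) w) ppsi.
  - apply: connected_continuous_connected; first exact: component_connected.
    exact: continuous_subspaceT.
move=> Ux; apply/seteqP; split; first exact: sub.
move=> z xz; exists (val (phi^-1)%g z).
- have e : val (phi^-1)%g (val phi x) = x.
    exact: (congr1 (fun f : deck p => val f x) (mulVg phi)).
  rewrite -[x in sheet p U x]e; apply: (sub (phi^-1)%g (val phi x)); last by exists z.
  by rewrite -[p (_ _)]/((p \o val phi) x) (deckP phi).2.
- exact: (congr1 (fun f : deck p => val f z) (mulgV phi)).
Qed.

(** [D] stands for the unramified part of [X], on which the automorphisms are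
    transitive along the fibres. Openness of [p] is only at hand on [D], so the
    components are compared through their traces on [D]: the image of each trace
    turns out to be all of the connected set [U `&` p @` D]. *)
Lemma transitive_on_components (X Y : topologicalType) (p : X -> Y)
    (D : set X) (U : set Y) (x x' : X) :
  locally_connected X -> continuous p ->
  dense D -> (forall O, open O -> open (p @` (O `&` D))) ->
  locally_connected_in (p @` D) ->
  (forall z z', D z -> D z' -> p z = p z' ->
    exists phi : deck p, val phi z = z' /\ val phi @` D `<=` D) ->
  open U -> connected U -> U (p x) -> U (p x') ->
  exists phi : deck p, val phi @` sheet p U x = sheet p U x'.
Proof.
move=> lcX cp dD oD lD tD oU cU Ux Ux'.
have sheet_open z : open (sheet p U z).
  by apply: open_component => //; move/continuousP: cp; exact.
have shadow z : U (p z) -> p @` (sheet p U z `&` D) = U `&` p @` D.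
  move=> Uz; apply: lD => //.
  - have [|w zw] := dD (sheet p U z) _ (sheet_open z); last by exists (p w); exists w.
    by exists z; exact: connected_component_refl.
  - exists (p @` (sheet p U z `&` D)); first exact: oD.
    apply/seteqP; split; last by move=> ? [].
    move=> _ [w [zw Dw] <-]; split; last by exists w.
    by split; [exact: connected_component_sub zw|exists w].
  - (* The complement in [U `&` p @` D] is the union of the images of the traces
       that are disjoint from the image of the trace at [z]. *)
    pose E := \bigcup_(w in [set w |
      sheet p U w `&` p @^-1` (p @` (sheet p U z `&` D)) `&` D = set0])
      p @` (sheet p U w `&` D).
    exists (~` E).
      by apply: open_closedC; apply: bigcup_open => w _; exact: oD.
    apply/seteqP; split.
    + move=> _ [w [zw Dw] <-]; split.
        by split; [exact: connected_component_sub zw|exists w].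
      move=> [v v0 [u [vu Du] uw]].
      suff : set0 u by [].
      by rewrite -v0; split=> //; split=> //; exists w.
    + move=> y [[Uy [w Dw wy]] nE]; subst y.
      have [u [[wu [v [zv Dv] vu]] Du]] :
          sheet p U w `&` p @^-1` (p @` (sheet p U z `&` D)) `&` D !=set0.
        apply/set0P/eqP => w0; apply: nE; exists w => //; exists w => //; split=> //.
        exact: connected_component_refl.
      have [phi [uv phiD]] := tD u v Du Dv (esym vu).
      exists (val phi w); last by rewrite -[p (_ _)]/((p \o val phi) w) (deckP phi).2.
      split; last by apply: phiD; exists w.
      rewrite (same_connected_component zv) -uv -deck_image_sheet.
        by exists w => //; exact: connected_component_sym.
      exact: connected_component_sub wu.
have : (p @` (sheet p U x `&` D)) !=set0.
  have [|w xw] := dD (sheet p U x) _ (sheet_open x); last by exists (p w); exists w.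
  by exists x; exact: connected_component_refl.
move=> [y xy]; have x'y : (p @` (sheet p U x' `&` D)) y by rewrite shadow// -(shadow x).
case: xy => z [xz Dz] zy; case: x'y => z' [xz' Dz'] zy'.
have [phi [phiz _]] := tD z z' Dz Dz' (etrans zy (esym zy')).
exists phi; rewrite (same_connected_component xz) (same_connected_component xz').
by rewrite -phiz deck_image_sheet//; exact: connected_component_sub xz.
Qed.

(** * Cosets of a stabilizer as translates *)

Section Translates.
Variables (X Y : topologicalType) (p : X -> Y).
Implicit Types (V : set X) (g h : deck p).

Lemma deck_mul_image g h V : val (g * h)%g @` V = val g @` (val h @` V).
Proof. by rewrite image_comp. Qed.

Lemma deck_inv_image g V W : val g @` V = W -> val (g^-1)%g @` W = V.
Proof. by move=> <-; rewrite -deck_mul_image mulVg; exact: image_id. Qed.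

(** The map [g H |-> g @` V], for [H] the stabilizer of [V]; being injective
    ([translate_inj]), it lets sets of points stand for cosets. *)
Definition translate V (c : cosets (@stabilizer X Y p V)) : set X :=
  val (coset_repr c) @` V.

Lemma to_coset_repr V (c : cosets (@stabilizer X Y p V)) :
  to_coset (stabilizer V) (coset_repr c) = c.
Proof. by rewrite /coset_repr; case: cid. Qed.

Lemma translate_to_coset V g :
  translate (to_coset (@stabilizer X Y p V) g) = val g @` V.
Proof.
rewrite /translate; have /(congr1 val) /= e :=
  to_coset_repr (to_coset (@stabilizer X Y p V) g).
have : lcoset (stabilizer V) (coset_repr (to_coset (@stabilizer X Y p V) g))
         (coset_repr (to_coset (@stabilizer X Y p V) g)).
  exists 1%g; last exact: mulg1.
  by have [] := stabilizer_subgroup p V.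
by rewrite e => -[h hV <-]; rewrite deck_mul_image hV.
Qed.

Lemma translate_inj V : injective (@translate V).
Proof.
have sub g g' : val g @` V = val g' @` V ->
    lcoset (@stabilizer X Y p V) g `<=` lcoset (@stabilizer X Y p V) g'.
  move=> gg' _ [h hV <-]; exists (g'^-1 * (g * h))%g; last by rewrite mulgA mulgV mul1g.
  change (val (g'^-1 * (g * h))%g @` V = V).
  rewrite !deck_mul_image hV gg'.
  exact: deck_inv_image.
move=> c c' cc'; rewrite -(to_coset_repr c) -(to_coset_repr c').
by apply: val_inj; apply/seteqP; split; apply: sub.
Qed.

End Translates.

(** * The fibre as a projective limit *)

Lemma continuous_coordinate (I : Type) (T : I -> topologicalType)
    (A : set (prod_topology T)) (i : I) :
  continuous (fun t : set_type A => (val t : forall i, T i) i).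
Proof.
move=> t; apply: (@continuous_comp _ _ _ (val : set_type A -> prod_topology T) (fun f => f i)).
  exact: initial_continuous.
exact: (@proj_continuous {classic I} T i).
Qed.

Lemma continuous_into_product (Z : topologicalType) (I : Type)
    (T : I -> topologicalType) (A : set (prod_topology T)) (f : Z -> set_type A) :
  (forall i, continuous (fun z => (val (f z) : forall i, T i) i)) ->
  continuous f.
Proof.
move=> cf; apply: continuous_comp_initial => z.
apply/cvg_sup => i N [_ [[W oW <-] Wz] WN].
apply: filterS WN _; apply: (cf i z).
exact: open_nbhs_nbhs.
Qed.

(** Everything is read off the relation between [x] and a family [t] of cosets
    saying that the translates given by [t] are the components containing [x]:
    it is the graph of a bijection between the fibre and the limit. *)
Lemma fiber_homeomorphic_projlim (X Y : topologicalType) (p : X -> Y)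
    (b : Y) (x0 : X) (I : Type) (U : I -> set Y) :
  locally_connected X -> hausdorff_space X ->
  locally_connected Y -> hausdorff_space Y ->
  spread p -> complete p -> p x0 = b -> connected_nbhs_basis b U ->
  (forall i x, U i (p x) ->
    exists phi : deck p, val phi @` sheet p (U i) x0 = sheet p (U i) x) ->
  homeomorphic
    (set_type (p @^-1` [set b]))
    (set_type (projlim (fun i j => U i `<=` U j)
      (T := fun i => cosets (@stabilizer _ _ p (sheet p (U i) x0)))
      (fun i j => coset_map (@stabilizer _ _ p (sheet p (U j) x0))))).
Proof.
move=> lcX hX lcY hY sp cp px0 [Ub Ubasis] tr.
set Gamma := fun i => @stabilizer _ _ p (sheet p (U i) x0).
have Ui i : U i b by case: (Ub i) => -[].
have Uix0 i : U i (p x0) by rewrite px0.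
have translateE i g : translate (to_coset (Gamma i) g) = sheet p (U i) (val g x0).
  by rewrite translate_to_coset deck_image_sheet.
have repr_x0 i (c : cosets (Gamma i)) : p (val (coset_repr c) x0) = b.
  by rewrite -px0; exact: (congr1 (fun f => f x0) (deckP (coset_repr c)).2).
have Gamma_sub i j : U i `<=` U j -> Gamma i `<=` Gamma j.
  move=> Uij g gi; have : (val g @` sheet p (U i) x0) (val g x0).
    by exists x0 => //; exact: connected_component_refl.
  rewrite [X in X _]gi => /(sheet_mono Uij (Uix0 i)) gx0.
  by rewrite /Gamma /stabilizer /= deck_image_sheet// -(same_connected_component gx0).
have translate_map i j (c : cosets (Gamma i)) : U i `<=` U j ->
    translate (coset_map (Gamma j) c) = sheet p (U j) (val (coset_repr c) x0).
  move=> Uij; rewrite -translateE -{1}(to_coset_repr c).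
  by rewrite (coset_mapE (stabilizer_subgroup _ _) (stabilizer_subgroup _ _)
    (Gamma_sub _ _ Uij)).
have coset_of x : p x = b -> exists t : forall i, cosets (Gamma i),
    forall i, translate (t i) = sheet p (U i) x.
  move=> px; have gP i : exists g : deck p, val g @` sheet p (U i) x0 = sheet p (U i) x.
    by apply: tr; rewrite px.
  have [g gE] := choice gP.
  by exists (fun i => to_coset (Gamma i) (g i)) => i; rewrite translate_to_coset gE.
pose represents x (t : forall i, cosets (Gamma i)) :=
  forall i, translate (t i) = sheet p (U i) x.
have represents_projlim x t : p x = b -> represents x t ->
    projlim (fun i j => U i `<=` U j) (T := fun i => cosets (Gamma i))
      (fun i j => coset_map (Gamma j)) t.
  move=> px xt i j Uij; apply: translate_inj.
  rewrite translate_map// xt; apply/esym/same_connected_component.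
  have : sheet p (U i) x (val (coset_repr (t i)) x0).
    by rewrite -xt; exists x0 => //; exact: connected_component_refl.
  by apply: sheet_mono => //; rewrite px.
have projlim_represents t : projlim (fun i j => U i `<=` U j)
      (T := fun i => cosets (Gamma i)) (fun i j => coset_map (Gamma j)) t ->
    exists x, p x = b /\ represents x t.
  move=> tlim; pose y i := val (coset_repr (t i)) x0.
  have tE i : translate (t i) = sheet p (U i) (y i).
    by rewrite -translateE to_coset_repr.
  have y_refine k i V : U k `<=` U i -> U i `<=` V -> sheet p V (y k) (y i).
    move=> Uki UiV; have := tE i; rewrite -(tlim k i Uki) translate_map// => e.
    have : sheet p (U i) (y k) (y i).
      by rewrite /y e; apply: connected_component_refl; rewrite /preimage /= repr_x0.
    by apply: sheet_mono => //; rewrite repr_x0.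
  have y_same i j V : U i `<=` V -> U j `<=` V ->
      sheet p V (y i) = sheet p V (y j).
    move=> UiV UjV.
    have [k Uk] : exists k, U k `<=` U i `&` U j.
      apply: Ubasis; apply: open_nbhs_nbhs; split=> //.
      by apply: openI; [case: (Ub i) => -[]|case: (Ub j) => -[]].
    have [Uki Ukj] : U k `<=` U i /\ U k `<=` U j.
      by split=> z /Uk[].
    by rewrite -(same_connected_component (y_refine k i V Uki UiV))
               (same_connected_component (y_refine k j V Ukj UjV)).
  (* Completeness asks for a component over every connected neighbourhood of
     [b], not only over the [U i]: take the one that contains the translates
     over all smaller [U i]. *)
  pose chi V := \bigcup_(i in [set i | U i `<=` V]) sheet p V (y i).
  have chiE V i : U i `<=` V -> chi V = sheet p V (y i).
    move=> UiV; apply/seteqP; split; last by move=> z yz; exists i.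
    by move=> z [k /= UkV]; rewrite (y_same k i).
  have inside V : connected_open_nbhs b V -> exists i, U i `<=` V.
    by move=> [/open_nbhs_nbhs bV _]; exact: Ubasis.
  have [|||x [px xE]] := @thread_point _ _ p b chi hY lcY cp.
  - by apply: subset_closure; exists x0.
  - move=> V /inside[i UiV]; exists (y i); last by rewrite (chiE V i).
    by apply: UiV; rewrite repr_x0.
  - move=> V W /inside[i UiV] _ VW; rewrite (chiE V i)// (chiE W i).
      by apply: sheet_mono => //; rewrite repr_x0; exact: UiV.
    exact: subset_trans VW.
  - by exists x; split=> // i; rewrite tE -(chiE (U i) i)// xE.
have represents_fun x t t' : represents x t -> represents x t' -> t = t'.
  move=> xt xt'; apply: functional_extensionality_dep => i.
  by apply: translate_inj; rewrite xt xt'.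
have represents_injective x x' t : p x = b -> p x' = b ->
    represents x t -> represents x' t -> x = x'.
  move=> px px' xt x't; apply: (spread_separated hX lcY sp) => V.
  rewrite px => -[/open_nbhs_nbhs /Ubasis[i UiV] _].
  have : sheet p (U i) x x'.
    by rewrite -xt x't; apply: connected_component_refl; rewrite /preimage /= px'.
  by apply: sheet_mono => //; rewrite px.
have fib (x : set_type (p @^-1` [set b])) : p (val x) = b by exact: set_mem (valP x).
pose L := set_type (projlim (fun i j => U i `<=` U j)
      (T := fun i => cosets (Gamma i)) (fun i j => coset_map (Gamma j))).
have fP (x : set_type (p @^-1` [set b])) : exists t : L, represents (val x) (val t).
  have [t xt] := coset_of (val x) (fib x).
  by exists (SigSub (mem_set (represents_projlim _ _ (fib x) xt))).
have gP (t : L) : exists x : set_type (p @^-1` [set b]), represents (val x) (val t).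
  have [x [px xt]] := projlim_represents (val t) (set_mem (valP t)).
  by exists (SigSub (mem_set (px : (p @^-1` [set b]) x))).
have [f fE] := choice fP; have [g gE] := choice gP.
exists f; split; last exists g; first last.
  split.
  - move=> t N; rewrite nbhsE => -[_ [[O oO <-] Ot] ON].
    have [V] := spread_basis lcY sp (open_nbhs_nbhs (conj oO Ot)).
    rewrite fib => -[/open_nbhs_nbhs /Ubasis[i UiV] _] VO.
    pose coord (t' : L) : cosets (Gamma i) :=
      (val t' : forall i, cosets (Gamma i)) i.
    have ti : nbhs t [set t' : L | coord t' = coord t].
      apply: (@continuous_coordinate _ _ _ i t [set coord t]).
      by apply: open_nbhs_nbhs; split=> //; exact: discrete_open.
    apply: filterS ti => t' /= t'i; apply: ON; apply: VO.
    have : sheet p (U i) (val (g t)) (val (g t')).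
      have <- : sheet p (U i) (val (g t')) = sheet p (U i) (val (g t)).
        by rewrite -(gE t' i) -(gE t i); congr (translate _).
      apply: connected_component_refl.
      by rewrite /preimage /= fib.
    by apply: sheet_mono => //; rewrite fib.
  - by move=> x; apply: val_inj; apply: (represents_injective _ _ (val (f x))).
  - by move=> t; apply: val_inj; apply: (represents_fun (val (g t))).
apply: continuous_into_product => i x N Nx.
have nx : nbhs x (val @^-1` sheet p (U i) (val x)
    : set (set_type (p @^-1` [set b]))).
  apply: open_nbhs_nbhs; split; last first.
    by apply: connected_component_refl; rewrite /preimage /= fib.
  exists (sheet p (U i) (val x)) => //; apply: open_component => //.
  by move/continuousP: sp.1; apply; case: (Ub i) => -[].
apply: filterS nx => x' xx'.
apply: (eq_ind _ N (nbhs_singleton Nx)); apply: translate_inj.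
by rewrite !fE (same_connected_component xx').
Qed.

(** * The quasi-Galois case *)

(** [p1] is open, as a covering, and [Y1] is open in [Y]; on the range of [j]
    the map [p] is [p1] in disguise. *)
Lemma open_image_dense_part (X1 X Y : topologicalType) (Y1 : set Y)
    (p1 : X1 -> set_type Y1) (p : X -> Y) (j : X1 -> X) (O : set X) :
  open Y1 -> covering p1 -> continuous j -> p \o j = set_val \o p1 ->
  open O -> open (p @` (O `&` range j)).
Proof.
move=> oY1 cov cj pj oO.
have -> : p @` (O `&` range j) = set_val @` (p1 @` (j @^-1` O)).
  apply/seteqP; split.
  - move=> _ [x [Ox [z _ zx]] <-]; subst x.
    exists (p1 z); first by exists z.
    exact: (congr1 (fun f => f z) (esym pj)).
  - move=> _ [_ [z Oz <-] <-]; exists (j z); first by split=> //; exists z.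
    exact: (congr1 (fun f => f z) pj).
apply: open_set_val => //; apply: covering_open => //.
by move/continuousP: cj; apply.
Qed.

Theorem proposition2p37 (R : realType) (X Y : topologicalType) (p : X -> Y)
    (S : set Y)
    (niceX : nice_space R X) (niceY : nice_space R Y)
    (p_bc : branched_covering p) (p_qG : quasi_galoisian R p)
    (p_S : possibly_branched_over p S)
    (b : Y) (bhat : X) (p_bhat : p bhat = b)
    (I : Type) (U : I -> set Y) (U_basis : connected_nbhs_basis b U) :
  let Uhat i := connected_component (p @^-1` U i) bhat in
  let Gamma i : set (deck p) := stabilizer (Uhat i) in
  homeomorphic
    (set_type (p @^-1` [set b]))
    (set_type (projlim (fun i j => U i `<=` U j)
                       (T := fun i => cosets (Gamma i))
                       (fun i j => coset_map (Gamma j)))).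
Proof.
case: niceX niceY => hX /locally_connected_of_paths lcX _.
move=> [hY /locally_connected_of_paths lcY _].
have [Y1 [X1 [p1 [j [[oY1 _ lY1] _ [cov tr1] [[_ sp cp ej pj] [oj dj lj]]]]]]] := p_qG.
have cj : continuous j by exact: embedding_continuous.
apply: fiber_homeomorphic_projlim => // i x Uix.
have [[oU Ub] cU] := U_basis.1 i.
have pjE z : p (j z) = set_val (p1 z) by exact: (congr1 (fun f => f z) pj).
apply: (@transitive_on_components _ _ _ (range j)) => //; last by rewrite p_bhat.
- exact: sp.1.
- by move=> O; apply: open_image_dense_part pj.
- suff -> : p @` range j = Y1 by [].
  apply/seteqP; split.
  + move=> _ [_ [z _ <-] <-]; rewrite pjE; exact: set_mem (valP _).
  + move=> y Yy; have [_ surj _] := cov.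
    have : range p1 (SigSub (mem_set Yy)) by rewrite surj.
    by move=> [z _ zy]; exists (j z); [exists z|rewrite pjE zy].
- move=> _ _ [z _ <-] [z' _ <-]; rewrite !pjE => /val_inj /tr1[phi1 phi1z].
  have [hphi1 pphi1] := deckP phi1.
  have [|phi phij] := deck_extension lcX lcY hX hY sp cp ej dj lj hphi1.
    by rewrite pj -compA pphi1.
  have phijE w : val phi (j w) = j (val phi1 w) by exact: (congr1 (fun f => f w) phij).
  exists phi; split; first by rewrite phijE phi1z.
  by move=> _ [_ [w _ <-] <-]; rewrite phijE; exists (val phi1 w).
Qed.
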